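(* Let $d\ge 1$. For each integer $m\ge0$ there is an algebra homomorphism $\pi_m:\widehat P_d^-\to A_{m+d}$ such that $$\pi_m(s_a)=\widehat s_{m+a},\qquad \pi_m(\varepsilon_a)=\widehat\varepsilon_{m+a},\qquad \pi_m(y_j)=z_{m+j}$$ for all $1\le a\le d-1$ and $1\le j\le d$.
   Context: The affine periplectic Brauer algebra $\widehat P_d^-$ is the associative unital $\mathbb C$-algebra generated by $s_a,\varepsilon_a$ ($1\le a\le d-1$), $y_j$ ($1\le j\le d$), subject to (for all indices for which the symbols make sense): (P.1) $s_a^2=1$; (P.2) $s_as_b=s_bs_a$ for $|a-b|>1$; $s_cs_{c+1}s_c=s_{c+1}s_cs_{c+1}$; $s_ay_i=y_is_a$ for $i\notin\{a,a+1\}$; (P.3) $\varepsilon_a^2=0$; (P.4) $\varepsilon_1y_1^k\varepsilon_1=0$ for all integers $k\ge1$; (P.5) $s_a\varepsilon_b=\varepsilon_bs_a$ and $\varepsilon_a\varepsilon_b=\varepsilon_b\varepsilon_a$ for $|a-b|>1$; $\varepsilon_ay_i=y_i\varepsilon_a$ for $i\notin\{a,a+1\}$; $y_iy_j=y_jy_i$; (P.6) $\varepsilon_as_a=-\varepsilon_a=-s_a\varepsilon_a$; $s_c\varepsilon_{c+1}\varepsilon_c=-s_{c+1}\varepsilon_c$, $\varepsilon_c\varepsilon_{c+1}s_c=\varepsilon_cs_{c+1}$; $\varepsilon_{c+1}\varepsilon_cs_{c+1}=-\varepsilon_{c+1}s_c$, $s_{c+1}\varepsilon_c\varepsilon_{c+1}=s_c\varepsilon_{c+1}$;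 $\varepsilon_{c+1}\varepsilon_c\varepsilon_{c+1}=-\varepsilon_{c+1}$, $\varepsilon_c\varepsilon_{c+1}\varepsilon_c=-\varepsilon_c$; (P.7) $s_ay_a-y_{a+1}s_a=\varepsilon_a-1$, $y_as_a-s_ay_{a+1}=-\varepsilon_a-1$; (P.8) $\varepsilon_a(y_a-y_{a+1})=\varepsilon_a$, $(y_a-y_{a+1})\varepsilon_a=-\varepsilon_a$. For an integer $N\ge1$, the periplectic Brauer algebra $A_N$ is the associative unital $\mathbb C$-algebra with generators $\widehat s_a,\widehat\varepsilon_a$ ($1\le a\le N-1$) and defining relations (for all indices for which the symbols make sense): $\widehat s_a^2=1$; $\widehat s_a\widehat s_b=\widehat s_b\widehat s_a$ for $|a-b|>1$; $\widehat s_c\widehat s_{c+1}\widehat s_c=\widehat s_{c+1}\widehat s_c\widehat s_{c+1}$; $\widehat\varepsilon_a^2=0$; $\widehat s_a\widehat\varepsilon_b=\widehat\varepsilon_b\widehat s_a$ and $\widehat\varepsilon_a\widehat\varepsilon_b=\widehat\varepsilon_b\widehat\varepsilon_a$ for $|a-b|>1$; $\widehat\varepsilon_a\widehat s_a=-\widehat\varepsilon_a=-\widehat s_a\widehat\varepsilon_a$; $\widehat s_c\widehat\varepsilon_{c+1}\widehat\varepsilon_c=-\widehat s_{c+1}\widehat\varepsilon_c$, $\widehat\varepsilon_c\widehat\varepsilon_{c+1}\widehat s_c=\widehat\varepsilon_c\widehat s_{c+1}$; $\widehat\varepsilon_{c+1}\widehat\varepsilon_c\widehat s_{c+1}=-\widehat\varepsilon_{c+1}\widehat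 s_c$, $\widehat s_{c+1}\widehat\varepsilon_c\widehat\varepsilon_{c+1}=\widehat s_c\widehat\varepsilon_{c+1}$; $\widehat\varepsilon_{c+1}\widehat\varepsilon_c\widehat\varepsilon_{c+1}=-\widehat\varepsilon_{c+1}$, $\widehat\varepsilon_c\widehat\varepsilon_{c+1}\widehat\varepsilon_c=-\widehat\varepsilon_c$. For $1\le i<j\le N$ set $(i,j)=\widehat s_i\cdots\widehat s_{j-2}\,\widehat s_{j-1}\,\widehat s_{j-2}\cdots\widehat s_i$ and $\overline{(i,j)}=\widehat s_i\cdots\widehat s_{j-2}\,\widehat\varepsilon_{j-1}\,\widehat s_{j-2}\cdots\widehat s_i$ in $A_N$. The Jucys–Murphy elements of $A_N$ are $z_1=0$ and $z_j=\sum_{1\le k\le j-1}\big((k,j)+\overline{(k,j)}\big)$ for $2\le j\le N$. *)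

(* Defs.v *)
From HB Require Import structures.
From mathcomp Require Import all_boot all_order all_algebra.
From mathcomp Require Import finmap monalg.
From mathcomp Require Import boolp.

Set Implicit Arguments.
Unset Strict Implicit.
Unset Printing Implicit Defensive.

Import GRing.Theory.
Local Open Scope ring_scope.
Local Open Scope quotient_scope.

Notation free_alg K X := {malg K[{fmonom X}]}.

Definition free_gen (K : comNzRingType) (X : choiceType) (x : X) :
    free_alg K X :=
  << fmu x >>.

(* The two-sided ideal generated by the differences u - v with rel u v. *)
Inductive gen_ideal (A : nzRingType) (rel : A -> A -> Prop) : A -> Prop :=
| GenIdealRel u v : rel u v -> gen_ideal rel (u - v)
| GenIdeal0 : gen_ideal rel 0
| GenIdealD u v : gen_ideal rel u -> gen_ideal rel v -> gen_ideal rel (u + v)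
| GenIdealMl a u : gen_ideal rel u -> gen_ideal rel (a * u)
| GenIdealMr a u : gen_ideal rel u -> gen_ideal rel (u * a).

Section FreeEval.
Variables (K : comNzRingType) (X : choiceType) (A : algType K) (f : X -> A).

Definition fmonom_eval (m : {fmonom X}) : A := \prod_(x <- m : seq X) f x.

Lemma fmonom_eval_mmorphism : mmorphism fmonom_eval.
Proof.
split=> [m n|]; first by rewrite /fmonom_eval fmM big_cat.
by rewrite /fmonom_eval fm1 big_nil.
Qed.

HB.instance Definition _ := isMultiplicative.Build _ _ fmonom_eval
  fmonom_eval_mmorphism.

Definition free_eval (u : free_alg K X) : A := mmap (in_alg A) fmonom_eval u.

Lemma free_eval_zmod_morphism : zmod_morphism free_eval.
Proof. exact: mmapB. Qed.

Lemma free_eval_monoid_morphism : monoid_morphism free_eval.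
Proof.
suff [eM e1] : multiplicative free_eval by split.
apply: commr_mmap_is_multiplicative => u m n.
by rewrite /GRing.comm -scalerAl mul1r -scalerAr mulr1.
Qed.

Lemma free_eval_scalable : scalable free_eval.
Proof. by move=> c u; rewrite /free_eval mmapZ -scalerAl mul1r. Qed.

HB.instance Definition _ := GRing.isZmodMorphism.Build _ _ free_eval
  free_eval_zmod_morphism.
HB.instance Definition _ := GRing.isMonoidMorphism.Build _ _ free_eval
  free_eval_monoid_morphism.
HB.instance Definition _ := GRing.isScalable.Build K _ _ *:%R free_eval
  free_eval_scalable.

Lemma free_eval_gen x : free_eval (free_gen K x) = f x.
Proof.
by rewrite /free_eval /free_gen mmapU /= scale1r mul1r /fmonom_eval fmU big_seq1.
Qed.

Lemma free_eval_gen_ideal (rel : free_alg K X -> free_alg K X -> Prop) u :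
    (forall v w, rel v w -> free_eval v = free_eval w) ->
  gen_ideal rel u -> free_eval u = 0.
Proof.
move=> rel_f; elim=> {u} [v w /rel_f fvw||u v _ fu _ fv|a u _ fu|a u _ fu].
- by rewrite raddfB /= fvw subrr.
- exact: raddf0.
- by rewrite raddfD /= fu fv addr0.
- by rewrite rmorphM /= fu mulr0.
- by rewrite rmorphM /= fu mul0r.
Qed.

End FreeEval.

(* MathComp algebras are nonzero, hence the last field. *)
Record presentation (K : comNzRingType) := Presentation {
  pres_gen : choiceType;
  pres_rel : free_alg K pres_gen -> free_alg K pres_gen -> Prop;
  pres_neq0 : ~ gen_ideal pres_rel 1
}.

Section PresentedAlgebra.
Variables (K : comNzRingType) (p : presentation K).
Local Notation F := (free_alg K (pres_gen p)).

Definition pres_ideal : {pred F} := [pred u | `[< gen_ideal (@pres_rel K p) u >]].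

Lemma pres_idealP u : reflect (gen_ideal (@pres_rel K p) u) (u \in pres_ideal).
Proof. exact: asboolP. Qed.

Lemma pres_ideal_zmod_closed : zmod_closed pres_ideal.
Proof.
split=> [|u v /pres_idealP Iu /pres_idealP Iv].
  exact/pres_idealP/GenIdeal0.
by apply/pres_idealP/GenIdealD => //; rewrite -mulN1r; apply: GenIdealMl.
Qed.

HB.instance Definition _ := GRing.isZmodClosed.Build F pres_ideal
  pres_ideal_zmod_closed.

Lemma pres_idealMl a u : u \in pres_ideal -> a * u \in pres_ideal.
Proof. by move/pres_idealP => Iu; apply/pres_idealP/GenIdealMl. Qed.

Lemma pres_idealMr a u : u \in pres_ideal -> u * a \in pres_ideal.
Proof. by move/pres_idealP => Iu; apply/pres_idealP/GenIdealMr. Qed.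

Lemma pres_idealZ c u : u \in pres_ideal -> c *: u \in pres_ideal.
Proof. by rewrite -mul_malgC; apply: pres_idealMl. Qed.

Lemma free_scalerAr (c : K) (u v : F) : c *: (u * v) = u * (c *: v).
Proof.
apply/malgP => k; rewrite mcoeffZ [in LHS]mcoeffMl mulr_sumr.
rewrite [RHS](mcoeffMlw k (fsubset_refl _) (msuppZ_le c v)).
apply: eq_bigr => k1 _; rewrite mulr_sumr; apply: eq_bigr => k2 _.
by rewrite mcoeffZ mulrnAr mulrCA.
Qed.

Definition presented := {ideal_quot pres_ideal}.

HB.instance Definition _ := GRing.Zmodule.on presented.

(* The operations are locked so that failing unifications stay cheap. *)
Fact pres_pi_key : unit. Proof. exact: tt. Qed.
Definition pres_pi : F -> presented :=
  locked_with pres_pi_key (fun u => \pi_presented u).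

Lemma pres_piE u : pres_pi u = \pi_presented u.
Proof. by rewrite /pres_pi unlock. Qed.

Lemma pres_piP u v : reflect (pres_pi u = pres_pi v) (u - v \in pres_ideal).
Proof. by rewrite Quotient.idealrBE !pres_piE; apply: eqP. Qed.

Lemma pres_pi_rel u v : pres_rel u v -> pres_pi u = pres_pi v.
Proof. by move=> uv; apply/pres_piP/pres_idealP/GenIdealRel. Qed.

Lemma pres_piK u : {i | i \in pres_ideal & repr (pres_pi u) = u + i}.
Proof.
exists (repr (pres_pi u) - u); last by rewrite addrC subrK.
by apply/pres_piP; rewrite [LHS]pres_piE reprK.
Qed.

Lemma pres_reprK (x : presented) : pres_pi (repr x) = x.
Proof. by rewrite pres_piE reprK. Qed.

Lemma pres_piD u v : pres_pi (u + v) = pres_pi u + pres_pi v.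
Proof. by rewrite !pres_piE; apply: Quotient.pi_add. Qed.

Fact pres_one_key : unit. Proof. exact: tt. Qed.
Definition pres_one : presented := locked_with pres_one_key (pres_pi 1).

Fact pres_mul_key : unit. Proof. exact: tt. Qed.
Definition pres_mul : presented -> presented -> presented :=
  locked_with pres_mul_key (fun x y => pres_pi (repr x * repr y)).

Fact pres_scale_key : unit. Proof. exact: tt. Qed.
Definition pres_scale : K -> presented -> presented :=
  locked_with pres_scale_key (fun c x => pres_pi (c *: repr x)).

Lemma pres_pi1 : pres_pi 1 = pres_one.
Proof. by rewrite /pres_one unlock. Qed.

Lemma pres_piM u v : pres_pi (u * v) = pres_mul (pres_pi u) (pres_pi v).
Proof.
rewrite /pres_mul unlock; case: (pres_piK u) => i Ii ->; case: (pres_piK v) => j Ij ->.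
apply/esym/pres_piP.
rewrite mulrDr mulrDl addrAC [_ + _ - _]addrAC subrr add0r.
by apply: rpredD; [apply: pres_idealMr | apply: pres_idealMl].
Qed.

Lemma pres_piZ c u : pres_pi (c *: u) = pres_scale c (pres_pi u).
Proof.
rewrite /pres_scale unlock; case: (pres_piK u) => i Ii ->.
by apply/esym/pres_piP; rewrite scalerDr addrC addKr pres_idealZ.
Qed.

Lemma pres_mulA : associative pres_mul.
Proof.
move=> x y z; rewrite -(pres_reprK x) -(pres_reprK y) -(pres_reprK z).
by rewrite -!pres_piM mulrA.
Qed.

Lemma pres_mul1 : left_id pres_one pres_mul.
Proof. by move=> x; rewrite -(pres_reprK x) -pres_pi1 -!pres_piM mul1r. Qed.

Lemma pres_mulr1 : right_id pres_one pres_mul.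
Proof. by move=> x; rewrite -(pres_reprK x) -pres_pi1 -!pres_piM mulr1. Qed.

Lemma pres_mulDl : left_distributive pres_mul +%R.
Proof.
move=> x y z; rewrite -(pres_reprK x) -(pres_reprK y) -(pres_reprK z).
by rewrite -pres_piD -!pres_piM mulrDl pres_piD.
Qed.

Lemma pres_mulDr : right_distributive pres_mul +%R.
Proof.
move=> x y z; rewrite -(pres_reprK x) -(pres_reprK y) -(pres_reprK z).
by rewrite -pres_piD -!pres_piM mulrDr pres_piD.
Qed.

Lemma pres_one_neq0 : pres_one != 0.
Proof.
apply/eqP; rewrite -pres_pi1 (_ : 0 = pres_pi 0); last first.
  by apply: (addrI (pres_pi 0)); rewrite -pres_piD !addr0.
by move/pres_piP; rewrite subr0 => /pres_idealP; apply: pres_neq0.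
Qed.

HB.instance Definition _ := GRing.Zmodule_isNzRing.Build presented
  pres_mulA pres_mul1 pres_mulr1 pres_mulDl pres_mulDr pres_one_neq0.

Lemma pres_scaleA a b x : pres_scale a (pres_scale b x) = pres_scale (a * b) x.
Proof. by rewrite -(pres_reprK x) -!pres_piZ scalerA. Qed.

Lemma pres_scale1 : left_id 1 pres_scale.
Proof. by move=> x; rewrite -(pres_reprK x) -!pres_piZ scale1r. Qed.

Lemma pres_scaleDr : right_distributive pres_scale +%R.
Proof.
move=> c x y; rewrite -(pres_reprK x) -(pres_reprK y).
by rewrite -pres_piD -!pres_piZ scalerDr pres_piD.
Qed.

Lemma pres_scaleDl x : {morph pres_scale^~ x : a b / a + b}.
Proof.
by move=> a b; rewrite -(pres_reprK x) -!pres_piZ scalerDl pres_piD.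
Qed.

HB.instance Definition _ := GRing.Zmodule_isLmodule.Build K presented
  pres_scaleA pres_scale1 pres_scaleDr pres_scaleDl.

Lemma pres_scaleAl c (x y : presented) : c *: (x * y) = (c *: x) * y.
Proof.
change (pres_scale c (pres_mul x y) = pres_mul (pres_scale c x) y).
rewrite -(pres_reprK x) -(pres_reprK y).
by rewrite -!(pres_piM, pres_piZ) scalerAl.
Qed.

Lemma pres_scaleAr c (x y : presented) : c *: (x * y) = x * (c *: y).
Proof.
change (pres_scale c (pres_mul x y) = pres_mul x (pres_scale c y)).
rewrite -(pres_reprK x) -(pres_reprK y).
by rewrite -!(pres_piM, pres_piZ) free_scalerAr.
Qed.

HB.instance Definition _ := GRing.Lmodule_isLalgebra.Build K presented
  pres_scaleAl.
HB.instance Definition _ := GRing.Lalgebra_isAlgebra.Build K presented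
  pres_scaleAr.

Lemma pres_pi_zmod_morphism : zmod_morphism pres_pi.
Proof.
by move=> u v; apply: (addIr (pres_pi v)); rewrite -pres_piD !subrK.
Qed.

Lemma pres_pi_monoid_morphism : monoid_morphism pres_pi.
Proof. by split=> [|u v]; [exact: pres_pi1 | exact: pres_piM]. Qed.

Lemma pres_pi_scalable : scalable pres_pi.
Proof. exact: pres_piZ. Qed.

HB.instance Definition _ := GRing.isZmodMorphism.Build F presented pres_pi
  pres_pi_zmod_morphism.
HB.instance Definition _ := GRing.isMonoidMorphism.Build F presented pres_pi
  pres_pi_monoid_morphism.
HB.instance Definition _ := GRing.isScalable.Build K F presented *:%R pres_pi
  pres_pi_scalable.

End PresentedAlgebra.

Arguments pres_pi {K} p u.

Lemma presented_lift (K : comNzRingType) (p : presentation K) (A : algType K)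
    (f : pres_gen p -> A) :
    (forall u v, pres_rel u v -> free_eval f u = free_eval f v) ->
  {g : {lrmorphism presented p -> A} |
    forall x, g (pres_pi p (free_gen K x)) = f x}.
Proof.
move=> rel_f; pose g (x : presented p) : A := free_eval f (repr x).
have g_pi u : g (pres_pi p u) = free_eval f u.
  rewrite /g; case: (@pres_piK _ p u) => i /pres_idealP Ii ->.
  by rewrite raddfD /= (free_eval_gen_ideal rel_f Ii) addr0.
have gB : zmod_morphism g.
  move=> x y; rewrite -(pres_reprK x) -(pres_reprK y).
  by rewrite -raddfB !g_pi raddfB.
have gM : monoid_morphism g.
  split=> [|x y]; first by rewrite -(rmorph1 (pres_pi p)) g_pi rmorph1.
  rewrite -(pres_reprK x) -(pres_reprK y).
  by rewrite -rmorphM !g_pi rmorphM.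
have gZ : scalable g.
  by move=> c x; rewrite -(pres_reprK x) -linearZ !g_pi linearZ.
pose gBI := GRing.isZmodMorphism.Build _ _ g gB.
pose gMI := GRing.isMonoidMorphism.Build _ _ g gM.
pose gZI := GRing.isScalable.Build K _ _ *:%R g gZ.
pose gL : {lrmorphism presented p -> A} := HB.pack g gBI gMI gZI.
by exists gL => x /=; rewrite g_pi free_eval_gen.
Qed.

(* The relations among the generators s_a, e_a, 1 <= a < N, shared by both
   families of algebras. *)
Inductive periplectic_rel (F : nzRingType) (N : nat) (s e : nat -> F) :
    F -> F -> Prop :=
| PRel_ss a of (1 <= a < N)%N :
    periplectic_rel N s e (s a * s a) 1
| PRel_ssC a b of (1 <= a < N)%N & (1 <= b < N)%N & (a.+1 < b)%N || (b.+1 < a)%N :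
    periplectic_rel N s e (s a * s b) (s b * s a)
| PRel_braid c of (1 <= c)%N & (c.+1 < N)%N :
    periplectic_rel N s e (s c * s c.+1 * s c) (s c.+1 * s c * s c.+1)
| PRel_ee a of (1 <= a < N)%N :
    periplectic_rel N s e (e a * e a) 0
| PRel_seC a b of (1 <= a < N)%N & (1 <= b < N)%N & (a.+1 < b)%N || (b.+1 < a)%N :
    periplectic_rel N s e (s a * e b) (e b * s a)
| PRel_eeC a b of (1 <= a < N)%N & (1 <= b < N)%N & (a.+1 < b)%N || (b.+1 < a)%N :
    periplectic_rel N s e (e a * e b) (e b * e a)
| PRel_es a of (1 <= a < N)%N :
    periplectic_rel N s e (e a * s a) (- e a)
| PRel_se a of (1 <= a < N)%N :
    periplectic_rel N s e (- e a) (- (s a * e a))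
| PRel_see c of (1 <= c)%N & (c.+1 < N)%N :
    periplectic_rel N s e (s c * e c.+1 * e c) (- (s c.+1 * e c))
| PRel_ees c of (1 <= c)%N & (c.+1 < N)%N :
    periplectic_rel N s e (e c * e c.+1 * s c) (e c * s c.+1)
| PRel_ees' c of (1 <= c)%N & (c.+1 < N)%N :
    periplectic_rel N s e (e c.+1 * e c * s c.+1) (- (e c.+1 * s c))
| PRel_see' c of (1 <= c)%N & (c.+1 < N)%N :
    periplectic_rel N s e (s c.+1 * e c * e c.+1) (s c * e c.+1)
| PRel_eee c of (1 <= c)%N & (c.+1 < N)%N :
    periplectic_rel N s e (e c.+1 * e c * e c.+1) (- e c.+1)
| PRel_eee' c of (1 <= c)%N & (c.+1 < N)%N :
    periplectic_rel N s e (e c * e c.+1 * e c) (- e c).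

Inductive affine_periplectic_rel (F : nzRingType) (d : nat) (s e y : nat -> F) :
    F -> F -> Prop :=
| ARel_periplectic u v of periplectic_rel d s e u v :
    affine_periplectic_rel d s e y u v
| ARel_sy a i of (1 <= a < d)%N & (1 <= i <= d)%N & i != a & i != a.+1 :
    affine_periplectic_rel d s e y (s a * y i) (y i * s a)
| ARel_eye k of (1 < d)%N & (1 <= k)%N :
    affine_periplectic_rel d s e y (e 1%N * y 1%N ^+ k * e 1%N) 0
| ARel_ey a i of (1 <= a < d)%N & (1 <= i <= d)%N & i != a & i != a.+1 :
    affine_periplectic_rel d s e y (e a * y i) (y i * e a)
| ARel_yyC i j of (1 <= i <= d)%N & (1 <= j <= d)%N :
    affine_periplectic_rel d s e y (y i * y j) (y j * y i)
| ARel_sy_ys a of (1 <= a < d)%N :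
    affine_periplectic_rel d s e y (s a * y a - y a.+1 * s a) (e a - 1)
| ARel_ys_sy a of (1 <= a < d)%N :
    affine_periplectic_rel d s e y (y a * s a - s a * y a.+1) (- e a - 1)
| ARel_e_yy a of (1 <= a < d)%N :
    affine_periplectic_rel d s e y (e a * (y a - y a.+1)) (e a)
| ARel_yy_e a of (1 <= a < d)%N :
    affine_periplectic_rel d s e y ((y a - y a.+1) * e a) (- e a).

(* Generators are indexed from 1 by natural numbers; out of the range P of the
   indices, the value is the junk 0. *)
Definition indexed_gen (K : comNzRingType) (X : choiceType) (P : pred nat)
    (inj : {a : nat | P a} -> X) (a : nat) : free_alg K X :=
  if insub a is Some i then free_gen K (inj i) else 0.

Lemma free_eval_indexed_gen (K : comNzRingType) (X : choiceType) (P : pred nat)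
    (inj : {a : nat | P a} -> X) (A : algType K) (f : X -> A) (a : nat)
    (Pa : P a) :
  free_eval f (indexed_gen K inj a) = f (inj (exist _ a Pa)).
Proof. by rewrite /indexed_gen insubT free_eval_gen. Qed.

(* The one-dimensional module s_a = 1, e_a = 0, y_j = j. *)
Lemma periplectic_rel_triv (F F' : nzRingType) (N : nat) (s e : nat -> F)
    (f : {rmorphism F -> F'}) u v :
    (forall a, (1 <= a < N)%N -> f (s a) = 1) ->
    (forall a, (1 <= a < N)%N -> f (e a) = 0) ->
  periplectic_rel N s e u v -> f u = f v.
Proof.
move=> fs fe; have ltS c : (1 <= c)%N -> (c.+1 < N)%N ->
  (1 <= c < N)%N * (1 <= c.+1 < N)%N.
  by move=> c1 cN; rewrite c1 (ltnW cN) cN.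
by case=> > => [?|? ?|/ltS c_ {}/c_[? ?]|?|? ?|? ?|?|?
  |/ltS c_ {}/c_[? ?]|/ltS c_ {}/c_[? ?]|/ltS c_ {}/c_[? ?]
  |/ltS c_ {}/c_[? ?]|/ltS c_ {}/c_[? ?]|/ltS c_ {}/c_[? ?]] => *;
  rewrite ?rmorphN ?rmorphM ?rmorph1 ?rmorph0 ?fs ?fe //
    ?mulr0 ?mul0r ?mulr1 ?mul1r ?oppr0.
Qed.

Lemma affine_periplectic_rel_triv (F : nzRingType) (F' : comNzRingType)
    (d : nat) (s e y : nat -> F) (f : {rmorphism F -> F'}) u v :
    (forall a, (1 <= a < d)%N -> f (s a) = 1) ->
    (forall a, (1 <= a < d)%N -> f (e a) = 0) ->
    (forall j, (1 <= j <= d)%N -> f (y j) = j%:R) ->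
  affine_periplectic_rel d s e y u v -> f u = f v.
Proof.
move=> fs fe fy.
have ltS a : (1 <= a < d)%N -> (1 <= a <= d)%N * (1 <= a.+1 <= d)%N.
  by case/andP=> a1 ad; rewrite a1 (ltnW ad) ad.
case=> {u v} [u v|a i aP iP _ _|k d1 _|a i aP iP _ _|i j iP jP
  |a aP|a aP|a aP|a aP].
- exact: periplectic_rel_triv.
- by rewrite !rmorphM fs // fy // mulrC.
- by rewrite !rmorphM fe ?d1 // mulr0 rmorph0.
- by rewrite !rmorphM fe // fy // mulrC.
- by rewrite !rmorphM !fy // mulrC.
- rewrite !rmorphB !rmorphM rmorph1 fs // fe // !fy ?(ltS _ aP) //.
  by rewrite mul1r mulr1 -natr1 opprD addNKr sub0r.
- rewrite !rmorphB rmorphN !rmorphM rmorph1 fs // fe // !fy ?(ltS _ aP) //.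
  by rewrite mul1r mulr1 -natr1 opprD addNKr oppr0 sub0r.
- by rewrite rmorphM fe // mul0r.
- by rewrite rmorphM rmorphN fe // mulr0 oppr0.
Qed.

Section PeriplecticBrauer.
Variables (K : comNzRingType) (N : nat).

Definition pb_gen : choiceType :=
  ({a : nat | (1 <= a < N)%N} + {a : nat | (1 <= a < N)%N})%type.

Definition pb_free_s : nat -> free_alg K pb_gen := indexed_gen K inl.
Definition pb_free_e : nat -> free_alg K pb_gen := indexed_gen K inr.

Definition pb_rel := periplectic_rel N pb_free_s pb_free_e.

Lemma pb_neq0 : ~ gen_ideal pb_rel 1.
Proof.
pose f (x : pb_gen) : K^o := if x is inl _ then 1 else 0.
move=> /(@free_eval_gen_ideal _ _ _ f) H; suff /eqP : 1 = 0 :> K^o.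
  by rewrite oner_eq0.
rewrite -(rmorph1 (free_eval f)); apply: H => u v.
by apply: periplectic_rel_triv => a aP; rewrite /= free_eval_indexed_gen.
Qed.

Definition pb_pres := Presentation pb_neq0.

Definition periplectic_brauer := presented pb_pres.

HB.instance Definition _ := GRing.Algebra.on periplectic_brauer.

Fact pb_s_key : unit. Proof. exact: tt. Qed.
Definition pb_s : nat -> periplectic_brauer :=
  locked_with pb_s_key (fun a => pres_pi pb_pres (pb_free_s a)).

Lemma pb_sE a : pb_s a = pres_pi pb_pres (pb_free_s a).
Proof. by rewrite /pb_s unlock. Qed.

Fact pb_e_key : unit. Proof. exact: tt. Qed.
Definition pb_e : nat -> periplectic_brauer :=
  locked_with pb_e_key (fun a => pres_pi pb_pres (pb_free_e a)).

Lemma pb_eE a : pb_e a = pres_pi pb_pres (pb_free_e a).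
Proof. by rewrite /pb_e unlock. Qed.

(* s_i ... s_(j-2) x s_(j-2) ... s_i *)
Definition pb_conj (x : periplectic_brauer) (i j : nat) : periplectic_brauer :=
  (\prod_(i <= k < j.-1) pb_s k) * x
  * \prod_(k <- rev (index_iota i j.-1)) pb_s k.

Definition pb_transp (i j : nat) := pb_conj (pb_s j.-1) i j.
Definition pb_btransp (i j : nat) := pb_conj (pb_e j.-1) i j.

Definition jucys_murphy (j : nat) : periplectic_brauer :=
  \sum_(1 <= k < j) (pb_transp k j + pb_btransp k j).

End PeriplecticBrauer.

Section AffinePeriplecticBrauer.
Variables (K : comNzRingType) (d : nat).

Definition apb_gen : choiceType :=
  ({a : nat | (1 <= a < d)%N} + {a : nat | (1 <= a < d)%N}
   + {j : nat | (1 <= j <= d)%N})%type.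

Definition apb_free_s : nat -> free_alg K apb_gen :=
  indexed_gen K (fun a => inl (inl a)).
Definition apb_free_e : nat -> free_alg K apb_gen :=
  indexed_gen K (fun a => inl (inr a)).
Definition apb_free_y : nat -> free_alg K apb_gen := indexed_gen K inr.

Definition apb_rel :=
  affine_periplectic_rel d apb_free_s apb_free_e apb_free_y.

Lemma apb_neq0 : ~ gen_ideal apb_rel 1.
Proof.
pose f (x : apb_gen) : K^o :=
  match x with inl (inl _) => 1 | inl (inr _) => 0 | inr j => (val j)%:R end.
move=> /(@free_eval_gen_ideal _ _ _ f) H; suff /eqP : 1 = 0 :> K^o.
  by rewrite oner_eq0.
rewrite -(rmorph1 (free_eval f)); apply: H => u v.
apply: affine_periplectic_rel_triv => a aP; by rewrite /= free_eval_indexed_gen.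
Qed.

Definition apb_pres := Presentation apb_neq0.

Definition affine_periplectic_brauer := presented apb_pres.

HB.instance Definition _ := GRing.Algebra.on affine_periplectic_brauer.

Fact apb_s_key : unit. Proof. exact: tt. Qed.
Definition apb_s : nat -> affine_periplectic_brauer :=
  locked_with apb_s_key (fun a => pres_pi apb_pres (apb_free_s a)).

Lemma apb_sE a : apb_s a = pres_pi apb_pres (apb_free_s a).
Proof. by rewrite /apb_s unlock. Qed.

Fact apb_e_key : unit. Proof. exact: tt. Qed.
Definition apb_e : nat -> affine_periplectic_brauer :=
  locked_with apb_e_key (fun a => pres_pi apb_pres (apb_free_e a)).

Lemma apb_eE a : apb_e a = pres_pi apb_pres (apb_free_e a).
Proof. by rewrite /apb_e unlock. Qed.

Fact apb_y_key : unit. Proof. exact: tt. Qed.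
Definition apb_y : nat -> affine_periplectic_brauer :=
  locked_with apb_y_key (fun j => pres_pi apb_pres (apb_free_y j)).

Lemma apb_yE j : apb_y j = pres_pi apb_pres (apb_free_y j).
Proof. by rewrite /apb_y unlock. Qed.

End AffinePeriplecticBrauer.

(* Main.v *)
Require Import Defs.
From mathcomp Require Import all_boot all_order all_algebra.
From mathcomp Require Import monalg boolp reals complex zify.

Set Implicit Arguments.
Unset Strict Implicit.
Unset Printing Implicit Defensive.

Import GRing.Theory.
Local Open Scope ring_scope.

(** Everything follows from the one-step recursion
      z_(j+1) = s_j z_j s_j + s_j + e_j,  z_1 = 0.
    It holds because conjugation by s_j turns (k, j) into (k, j+1), by the
    braid relation, and likewise for the barred elements, since
    s_c e_(c+1) s_c = s_(c+1) e_c s_(c+1); the term k = j contributes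
    s_j + e_j.  From then on only a ring with elements s, e satisfying the
    relations of A_N and a sequence z satisfying the recursion are needed.

    - s_a and e_a commute with z_i for i outside {a, a+1}.  For i < a this is
      the far commutativity, and for i > a + 2 it propagates along the
      recursion, so the content is i = a + 2, a computation with three
      adjacent strands ([comm_s_conj2], [comm_e_conj2]).  As z_i is built from
      the s_a, e_a with a < i, the z_i commute with one another.
    - The relations that exchange s_a with y_a and y_(a+1) are the recursion
      multiplied by s_a on either side.
    - The relations e_a z_(a+1) = e_a (z_a - 1) and z_(a+1) e_a = (z_a + 1) e_a
      amount, by the recursion, to e_a z_a s_a = - e_a z_a and
      s_a z_a e_a = z_a e_a, which hold by induction on a ([e_jm_s],
      [s_jm_e]).
    - The relations e_1 y_1^k e_1 = 0 are a formal consequence of these.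
      Evaluating e_a z_(a+1) z_a^k e_a = e_a z_a^k z_(a+1) e_a in the two
      ways gives - e_a z_a^k e_a = e_a z_a^k e_a, so that the element vanishes
      as soon as 2 is invertible ([e_jm_e]).  This argument works at every
      index a, in particular at a = m + 1, where z_a need not vanish.

    The universal property of the presentation then yields the
    homomorphism. *)

(** * Jucys-Murphy sequences in a ring with periplectic Brauer relations *)

Section JucysMurphyRing.
Variables (A : nzRingType) (N : nat) (s e : nat -> A).
Hypothesis rel : forall u v, periplectic_rel N s e u v -> u = v.

Lemma s_invol a : (0 < a < N)%N -> s a * s a = 1.
Proof. by move=> aN; apply/rel/PRel_ss. Qed.

Lemma e_s a : (0 < a < N)%N -> e a * s a = - e a.
Proof. by move=> aN; apply/rel/PRel_es. Qed.

Lemma s_e a : (0 < a < N)%N -> s a * e a = e a.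
Proof. by move=> aN; apply/esym/oppr_inj/rel/PRel_se. Qed.

Section ThreeStrands.
Variable c : nat.
Hypotheses (c0 : (0 < c)%N) (cN : (c.+1 < N)%N).

Let cr : (0 < c < N)%N. Proof. by rewrite c0 ltnW. Qed.

Lemma transp_conj_next :
  s c * s c.+1 * s c = s c.+1 * s c * s c.+1.
Proof. exact/rel/PRel_braid. Qed.

(** The analogue of the braid relation for e: both sides equal
    s_(c+1) e_c e_(c+1) s_c, by the two ways of absorbing a product of adjacent
    e's. *)
Lemma btransp_conj_next :
  s c * e c.+1 * s c = s c.+1 * e c * s c.+1.
Proof.
rewrite -(rel (PRel_see' _ _ c0 cN)) -2!mulrA (mulrA (e c)).
by rewrite (rel (PRel_ees _ _ c0 cN)) mulrA.
Qed.

Lemma e_s_s_next : e c * s c.+1 * s c = e c * e c.+1.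
Proof.
by rewrite -(rel (PRel_ees _ _ c0 cN)) -mulrA s_invol // mulr1.
Qed.

Lemma s_s_e_next : s c * s c.+1 * e c = - (e c.+1 * e c).
Proof.
rewrite -mulrA -[s c.+1 * _]opprK -(rel (PRel_see _ _ c0 cN)) mulrN.
by rewrite !mulrA s_invol // mul1r.
Qed.

Lemma e_s_s_prev : e c.+1 * s c * s c.+1 = - (e c.+1 * e c).
Proof.
rewrite -[e c.+1 * s c]opprK -(rel (PRel_ees' _ _ c0 cN)) mulNr.
by rewrite -(mulrA _ (s c.+1)) s_invol // mulr1.
Qed.

Lemma s_s_e_prev : s c.+1 * s c * e c.+1 = e c * e c.+1.
Proof.
by rewrite -mulrA -(rel (PRel_see' _ _ c0 cN)) !mulrA s_invol // mul1r.
Qed.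

Variable x : A.
Hypotheses (sx : GRing.comm (s c.+1) x) (ex : GRing.comm (e c.+1) x).

(** With x = z_c this expands z_(c+2) through two steps of the recursion. *)
Lemma conj2E :
  s c.+1 * (s c * x * s c + s c + e c) * s c.+1 + s c.+1 + e c.+1
  = s c.+1 * s c * x * (s c * s c.+1)
    + (s c * s c.+1 * s c + s c * e c.+1 * s c + s c.+1 + e c.+1).
Proof.
by rewrite !mulrDr !mulrDl !mulrA transp_conj_next btransp_conj_next -!addrA.
Qed.

(** The braid relation moves s_c through the word s_(c+1) s_c x s_c s_(c+1),
    becoming s_(c+1) next to x; left multiplication by s_c permutes the
    remaining four terms into those of right multiplication. *)
Lemma comm_s_conj2 : GRing.comm (s c)
  (s c.+1 * (s c * x * s c + s c + e c) * s c.+1 + s c.+1 + e c.+1).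
Proof.
have l y : s c * (s c * y) = y by rewrite mulrA s_invol // mul1r.
rewrite conj2E; apply: commrD; rewrite /GRing.comm.
  rewrite !mulrA transp_conj_next -(mulrA (s c.+1 * s c)) sx.
  rewrite -!mulrA; do 3 congr (_ * _).
  by rewrite !mulrA transp_conj_next.
rewrite !mulrDr !mulrDl -!mulrA !l s_invol // !mulr1.
by rewrite -!addrA addrA [RHS]addrA addrC.
Qed.

(** Both products of e_c with the word in x reduce to - e_c x e_(c+1) e_c, and
    e_c annihilates the sum of the other four terms on either side. *)
Lemma comm_e_conj2 : GRing.comm (e c)
  (s c.+1 * (s c * x * s c + s c + e c) * s c.+1 + s c.+1 + e c.+1).
Proof.
rewrite conj2E; apply: commrD; rewrite /GRing.comm.
  transitivity (- (e c * x * (e c.+1 * e c))).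
    rewrite !mulrA e_s_s_next -(mulrA _ _ x) ex -!mulrA.
    by rewrite (mulrA (e c.+1) (s c)) e_s_s_prev !mulrN.
  rewrite -[RHS]mulrA s_s_e_next mulrN; congr (- _).
  rewrite [RHS]mulrA -(mulrA (s c.+1 * s c)) -ex [in RHS]mulrA s_s_e_prev.
  by rewrite -(mulrA _ _ x) ex !mulrA.
have ee : e c * e c.+1 * s c = e c * s c.+1 by apply/rel/PRel_ees.
have se : s c * e c.+1 * e c = - (s c.+1 * e c) by apply/rel/PRel_see.
transitivity (0 : A); rewrite !(mulrDl, mulrDr) -?mulrA.
  rewrite !(mulrA (e c) (s c)) e_s // !mulNr !mulrA e_s_s_next ee.
  by rewrite -addrA [X in _ + X]addrC addrACA !addNr addr0.
rewrite s_e // !mulrA s_s_e_next se.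
by rewrite -addrA [X in _ + X]addrC addrACA !addNr addr0.
Qed.

End ThreeStrands.

(** The sequence z is pinned down by its recursion alone: the explicit sums
    that define the Jucys-Murphy elements serve only to establish it. *)
Variable z : nat -> A.
Hypothesis z1 : z 1%N = 0.
Hypothesis zS : forall j, (0 < j < N)%N -> z j.+1 = s j * z j * s j + s j + e j.

Lemma comm_far a b : (0 < a < N)%N -> (0 < b < N)%N ->
    (a.+1 < b)%N || (b.+1 < a)%N ->
  [/\ GRing.comm (s a) (s b), GRing.comm (s a) (e b),
      GRing.comm (e a) (s b) & GRing.comm (e a) (e b)].
Proof.
move=> aN bN ab; have ba : (b.+1 < a)%N || (a.+1 < b)%N by rewrite orbC.
split; first by apply/rel/PRel_ssC.
- exact/rel/PRel_seC.
- exact/commr_sym/rel/PRel_seC.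
- exact/rel/PRel_eeC.
Qed.

(** At i = a + 2 the two steps of the recursion are unfolded at once: s_(a+1)
    does not commute with s_a, so the one-step induction fails there. *)
Lemma jm_comm_gen i a : (0 < i <= N)%N -> (0 < a < N)%N ->
    i != a -> i != a.+1 ->
  GRing.comm (s a) (z i) /\ GRing.comm (e a) (z i).
Proof.
elim/ltn_ind: i a => -[//|[|i]] IH a iN aN ia iSa.
  by rewrite z1; split; apply: commr0.
have iN1 : (0 < i.+1 < N)%N by lia.
have [ai|ai] := eqVneq i a.
  subst a; have [|||||sx ex] := IH i _ i.+1; [lia..|].
  rewrite zS // zS; last lia.
  by split; [apply: comm_s_conj2 => //|apply: comm_e_conj2 => //]; lia.
have [|||||sz ez] := IH i.+1 _ a; [lia..|].
have [||ss se es ee] := @comm_far a i.+1 aN; [lia..|].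
rewrite zS //; split.
  by do 2 (apply: commrD => //); do 2 (apply: commrM => //).
by do 2 (apply: commrD => //); do 2 (apply: commrM => //).
Qed.

Lemma comm_jm x i : (0 < i <= N)%N ->
    (forall a, (0 < a < i)%N -> GRing.comm x (s a) /\ GRing.comm x (e a)) ->
  GRing.comm x (z i).
Proof.
elim: i => [//|[|i] IH] iN xse; first by rewrite z1; apply: commr0.
have [|xs xe] := xse i.+1; first lia.
have xz : GRing.comm x (z i.+1) by apply: IH => [|a ?]; [lia|apply: xse; lia].
rewrite zS; last lia.
by do 2 (apply: commrD => //); do 2 (apply: commrM => //).
Qed.

Lemma jm_comm i j : (0 < i <= N)%N -> (0 < j <= N)%N -> GRing.comm (z i) (z j).
Proof.
wlog ij : i j / (i < j)%N => [H iN jN|iN jN].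
  have [ij|ji|->] := ltngtP i j; [exact: H| |by []].
  exact/commr_sym/H.
apply/commr_sym/comm_jm => // a ai.
have [||||sz ez] := @jm_comm_gen j a; [lia..|].
by split; apply: commr_sym.
Qed.

Lemma jm_s_swap a : (0 < a < N)%N -> s a * z a - z a.+1 * s a = e a - 1.
Proof.
move=> aN; rewrite zS // !mulrDl -(mulrA _ (s a)) s_invol // mulr1 e_s //.
by rewrite !opprD opprK -addrA addNKr addrC.
Qed.

Lemma jm_swap_s a : (0 < a < N)%N -> z a * s a - s a * z a.+1 = - e a - 1.
Proof.
move=> aN; rewrite zS // !mulrDr !mulrA s_invol // mul1r s_e //.
by rewrite !opprD -addrA addNKr addrC.
Qed.

(** The induction inserts e_a through e_(a+1) s_a = - e_(a+1) e_a s_(a+1); the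
    factor s_(a+1) then passes z_a, and the braid relation brings a factor s_a
    next to e_a z_a, where the induction hypothesis applies. *)
Lemma e_jm_s a : (0 < a < N)%N -> e a * z a * s a = - (e a * z a).
Proof.
elim: a => [//|[|c] IH] aN; first by rewrite z1 mulr0 mul0r oppr0.
set k := c.+1 in IH aN *.
have kN : (0 < k < N)%N by lia.
have [||||sz ez] := @jm_comm_gen k k.+1; [lia..|].
have es : e k.+1 * s k = - (e k.+1 * e k * s k.+1).
  by apply: oppr_inj; rewrite opprK; apply/esym/rel/PRel_ees'; lia.
have braid : s k * s k.+1 * s k = s k.+1 * s k * s k.+1.
  by apply: transp_conj_next; lia.
have conj : e k.+1 * (s k * z k * s k) * s k.+1
          = - (e k.+1 * (s k * z k * s k)).
  rewrite !mulrA es !mulNr -(mulrA _ _ (z k)) sz; congr (- _).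
  rewrite -!mulrA (mulrA (s k.+1)) -braid.
  rewrite !mulrA -(mulrA _ (e k)) -(mulrA _ (e k * z k)) IH //.
  by rewrite mulrN !mulNr.
rewrite zS // !mulrDr !mulrDl conj.
by rewrite e_s_s_prev // es !opprD opprK addrAC.
Qed.

(** As for [e_jm_s], now with s_a e_(a+1) = s_(a+1) e_a e_(a+1). *)
Lemma s_jm_e a : (0 < a < N)%N -> s a * z a * e a = z a * e a.
Proof.
elim: a => [//|[|c] IH] aN; first by rewrite z1 mulr0 mul0r.
set k := c.+1 in IH aN *.
have kN : (0 < k < N)%N by lia.
have [||||sz ez] := @jm_comm_gen k k.+1; [lia..|].
have tef : s k.+1 * e k * e k.+1 = s k * e k.+1 by apply/rel/PRel_see'; lia.
have braid : s k * s k.+1 * s k = s k.+1 * s k * s k.+1.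
  by apply: transp_conj_next; lia.
have conj : s k.+1 * (s k * z k * s k) * e k.+1 = s k * z k * s k * e k.+1.
  rewrite !mulrA -!(mulrA _ (s k) (e _)) -tef !mulrA.
  rewrite -!(mulrA _ (z k) (s k.+1)) -sz !mulrA -braid.
  rewrite -(mulrA _ (s k)) -(mulrA _ _ (e k)) IH //.
  by rewrite !mulrA -(mulrA _ _ (z k)) sz !mulrA.
rewrite zS // !(mulrDr, mulrDl) conj s_s_e_prev //.
by rewrite tef -!addrA; congr (_ + _); rewrite addrC.
Qed.

Lemma e_jm_next a : (0 < a < N)%N -> e a * z a.+1 = e a * (z a - 1).
Proof.
move=> aN; rewrite zS // !mulrDr !mulrA e_s // !mulNr e_jm_s // opprK.
by rewrite (rel (PRel_ee _ _ aN)) addr0 mulrN mulr1.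
Qed.

Lemma jm_next_e a : (0 < a < N)%N -> z a.+1 * e a = (z a + 1) * e a.
Proof.
move=> aN; rewrite zS // !mulrDl -(mulrA _ (s a)) s_e // s_jm_e //.
by rewrite (rel (PRel_ee _ _ aN)) addr0 mul1r.
Qed.

Hypothesis torsion_free2 : forall x : A, x + x = 0 -> x = 0.

(** Sliding z_(a+1) to the left cap or to the right cup of
    e_a z_a^k z_(a+1) e_a gives the values e_a z_a^k (z_a - 1) e_a and
    e_a z_a^k (z_a + 1) e_a, whose difference is twice the element. *)
Lemma e_jm_e a k : (0 < a < N)%N -> e a * z a ^+ k * e a = 0.
Proof.
move=> aN.
have zz : GRing.comm (z a.+1) (z a ^+ k) by apply/commrX/jm_comm; lia.
have : e a * z a.+1 * z a ^+ k * e a = e a * z a ^+ k * z a.+1 * e a.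
  by rewrite -(mulrA (e a)) zz !mulrA.
rewrite e_jm_next // -(mulrA _ (z a.+1)) jm_next_e //.
have -> : e a * (z a - 1) * z a ^+ k = e a * z a ^+ k * (z a - 1).
  rewrite -!mulrA; congr (_ * _).
  by rewrite mulrBl mulrBr mul1r mulr1 -exprS -exprSr.
rewrite mulrBr mulr1 mulrBl mulrDl mul1r mulrDr !mulrA.
by move/addrI/eqP; rewrite eq_sym -addr_eq0 => /eqP/torsion_free2.
Qed.

(** The relations at the indices a of the affine algebra are relations at the
    indices m + a; for e_1 y_1^k e_1 = 0 this uses [e_jm_e] at m + 1. *)
Lemma jm_affine m d u v : (m + d <= N)%N ->
  affine_periplectic_rel d (fun a => s (m + a)%N) (fun a => e (m + a)%N)
    (fun j => z (m + j)%N) u v -> u = v.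
Proof.
move=> mdN.
case=> {u v} [u v r|a i aP iP ia iSa|k d1 _|a i aP iP ia iSa|i j iP jP
  |a aP|a aP|a aP|a aP].
- apply: rel; case: r => >; rewrite ?addnS => *; constructor; lia.
- by have [||||sz ez] := @jm_comm_gen (m + i) (m + a); [lia..|].
- by apply: e_jm_e; lia.
- by have [||||sz ez] := @jm_comm_gen (m + i) (m + a); [lia..|].
- by apply: jm_comm; lia.
- by rewrite addnS; apply: jm_s_swap; lia.
- by rewrite addnS; apply: jm_swap_s; lia.
- rewrite addnS mulrBr e_jm_next; last lia.
  by rewrite mulrBr mulr1 opprB addrC subrK.
- rewrite addnS mulrBl jm_next_e; last lia.
  by rewrite mulrDl mul1r opprD addNKr.
Qed.

End JucysMurphyRing.

(** * Transport of the relations along ring morphisms *)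

Section RelationTransfer.
Variables (F F' : nzRingType) (f : {rmorphism F -> F'}) (N : nat).

(** Turns relations imposed in a free algebra into identities in its
    quotient. *)
Lemma periplectic_rel_pull (s e : nat -> F) :
    (forall u v, periplectic_rel N s e u v -> f u = f v) ->
  forall u v, periplectic_rel N (f \o s) (f \o e) u v -> u = v.
Proof.
move=> rel u v; case=> > *; rewrite /= -?rmorphM -?rmorphN -?rmorphM -?rmorphN
  -?(rmorph1 f) -?(rmorph0 f); by apply: rel; constructor.
Qed.

(** The images are prescribed only on the valid indices: outside them the
    generators of a presented algebra take the default value 0, which the
    shifted generators need not do. *)
Lemma periplectic_rel_map (s e : nat -> F) (s' e' : nat -> F') u v :
    (forall a, (1 <= a < N)%N -> f (s a) = s' a) ->
    (forall a, (1 <= a < N)%N -> f (e a) = e' a) ->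
  periplectic_rel N s e u v -> periplectic_rel N s' e' (f u) (f v).
Proof.
move=> fs fe; case=> > *;
  rewrite ?(rmorphN, rmorphM, rmorph1, rmorph0) ?(fs, fe);
  by [constructor|lia].
Qed.

Lemma affine_periplectic_rel_map (s e y : nat -> F) (s' e' y' : nat -> F') u v :
    (forall a, (1 <= a < N)%N -> f (s a) = s' a) ->
    (forall a, (1 <= a < N)%N -> f (e a) = e' a) ->
    (forall j, (1 <= j <= N)%N -> f (y j) = y' j) ->
  affine_periplectic_rel N s e y u v ->
  affine_periplectic_rel N s' e' y' (f u) (f v).
Proof.
move=> fs fe fy; case=> > *.
  by apply/ARel_periplectic/(periplectic_rel_map fs fe).
all: rewrite ?(rmorphB, rmorphN, rmorphM, rmorphXn, rmorph1, rmorph0);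
  rewrite ?(fs, fe, fy);
  by [constructor|lia].
Qed.

End RelationTransfer.

(** * The recursion for the Jucys-Murphy elements *)

Section JucysMurphyRecursion.
Variables (K : comNzRingType) (N : nat).
Local Notation s := (pb_s K N).
Local Notation e := (pb_e K N).

Lemma pb_periplectic u v : periplectic_rel N s e u v -> u = v.
Proof.
have -> : s = pres_pi (pb_pres K N) \o pb_free_s K N.
  by apply/funext => a /=; rewrite pb_sE.
have -> : e = pres_pi (pb_pres K N) \o pb_free_e K N.
  by apply/funext => a /=; rewrite pb_eE.
(* The ascriptions make the ring structures of both sides syntactically those
   expected by the transfer lemma. *)
pose pr : {rmorphism free_alg K (pb_gen N) -> periplectic_brauer K N} :=
  (pres_pi (pb_pres K N) : {rmorphism _ -> presented (pb_pres K N)}).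
apply: (periplectic_rel_pull (f := pr)) => {}u {}v.
exact: (@pres_pi_rel _ (pb_pres K N)).
Qed.

Lemma pb_conj_recr x i c : (i <= c)%N ->
  pb_conj x i c.+2 = pb_conj (s c * x * s c) i c.+1.
Proof.
move=> ic; rewrite /pb_conj /= big_nat_recr //= /index_iota subSn // -addn1.
rewrite iotaD subnKC // cats1 rev_rcons big_cons.
by rewrite !mulrA.
Qed.

Lemma pb_conj_comm x y i j :
    (forall k, (i <= k < j.-1)%N -> GRing.comm y (s k)) ->
  pb_conj (y * x * y) i j = y * pb_conj x i j * y.
Proof.
move=> ys; rewrite /pb_conj.
have yl : GRing.comm y (\prod_(i <= k < j.-1) s k).
  by rewrite big_nat; apply: commr_prod.
have yr : GRing.comm y (\prod_(k <- rev (index_iota i j.-1)) s k).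
  rewrite big_seq; apply: commr_prod => k; rewrite mem_rev mem_index_iota.
  exact: ys.
by rewrite !mulrA -yl -!mulrA -yr.
Qed.

(** The outer factors s_i, ..., s_(c-1) commute with s_(c+1), which therefore
    comes out of the conjugation; only the core has to be transformed. *)
Lemma pb_conj_next x x' c i : (0 < i <= c)%N -> (c.+1 < N)%N ->
    s c * x' * s c = s c.+1 * x * s c.+1 ->
  pb_conj x' i c.+2 = s c.+1 * pb_conj x i c.+1 * s c.+1.
Proof.
move=> /andP[i0 ic] cN xx'; rewrite pb_conj_recr // xx' pb_conj_comm // => k.
move=> /= kc.
by have [|||] := comm_far pb_periplectic (a := c.+1) (b := k); [lia..|].
Qed.

Lemma jucys_murphy1 : jucys_murphy K N 1 = 0.
Proof. by rewrite /jucys_murphy big_geq. Qed.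

Lemma jucys_murphyS j : (0 < j < N)%N ->
  jucys_murphy K N j.+1 = s j * jucys_murphy K N j * s j + s j + e j.
Proof.
case: j => // j jN; rewrite /jucys_murphy big_nat_recr //= -addrA.
congr (_ + _); last first.
  by rewrite /pb_transp /pb_btransp /pb_conj /index_iota subnn /=
    !big_nil !mul1r !mulr1.
rewrite mulr_sumr mulr_suml !big_nat; apply: eq_bigr => i ij.
rewrite mulrDr mulrDl /pb_transp /pb_btransp /=.
case: j jN ij => [|j] jN ij; first lia.
congr (_ + _); apply: pb_conj_next => //.
- by apply: (transp_conj_next pb_periplectic).
- by apply: (btransp_conj_next pb_periplectic).
Qed.

End JucysMurphyRecursion.

(** * The homomorphism *)

Section AffineHom.
Variables (K : comNzRingType) (half : K) (m d : nat).
Hypothesis halfD : half + half = 1.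
Local Notation N := (m + d)%N.
Local Notation A := (periplectic_brauer K N).

Lemma pb_torsion_free2 (x : A) : x + x = 0 -> x = 0.
Proof.
by move=> xx; rewrite -[x]scale1r -halfD scalerDl -scalerDr xx scaler0.
Qed.

Lemma pb_jm_affine u v :
  affine_periplectic_rel d
    (fun a => pb_s K N (m + a)) (fun a => pb_e K N (m + a))
    (fun j => jucys_murphy K N (m + j)) u v -> u = v.
Proof.
apply: jm_affine (leqnn N).
- exact: pb_periplectic.
- exact: jucys_murphy1.
- exact: jucys_murphyS.
- exact: pb_torsion_free2.
Qed.

Definition shift_gen (x : apb_gen d) : A :=
  match x with
  | inl (inl a) => pb_s K N (m + val a)
  | inl (inr a) => pb_e K N (m + val a)
  | inr j => jucys_murphy K N (m + val j)
  end.

Lemma shift_gen_rel u v :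
  pres_rel (p := apb_pres K d) u v ->
  free_eval shift_gen u = free_eval shift_gen v.
Proof.
move=> uv; apply: pb_jm_affine.
apply: affine_periplectic_rel_map uv => a aP; exact: free_eval_indexed_gen.
Qed.

Lemma shift_hom :
  exists pi : {lrmorphism affine_periplectic_brauer K d -> A},
    [/\ forall a, (1 <= a < d)%N -> pi (apb_s K d a) = pb_s K N (m + a),
        forall a, (1 <= a < d)%N -> pi (apb_e K d a) = pb_e K N (m + a) &
        forall j, (1 <= j <= d)%N ->
          pi (apb_y K d j) = jucys_murphy K N (m + j)].
Proof.
have [pi piE] := presented_lift shift_gen_rel.
exists pi; split=> a aP.
- by rewrite apb_sE /apb_free_s /indexed_gen insubT piE.
- by rewrite apb_eE /apb_free_e /indexed_gen insubT piE.
- by rewrite apb_yE /apb_free_y /indexed_gen insubT piE.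
Qed.

End AffineHom.

Theorem theorem4p3 (R : realType) (d : nat) (hd : (1 <= d)%N) (m : nat) :
  exists pi : {lrmorphism affine_periplectic_brauer R[i] d
                 -> periplectic_brauer R[i] (m + d)%N},
    [/\ forall a : nat, (1 <= a <= d - 1)%N ->
          pi (apb_s R[i] d a) = pb_s R[i] (m + d)%N (m + a)%N,
        forall a : nat, (1 <= a <= d - 1)%N ->
          pi (apb_e R[i] d a) = pb_e R[i] (m + d)%N (m + a)%N &
        forall j : nat, (1 <= j <= d)%N ->
          pi (apb_y R[i] d j) = jucys_murphy R[i] (m + d)%N (m + j)%N].
Proof.
have half : 2^-1 + 2^-1 = 1 :> R[i] by rewrite [RHS]Num.Theory.splitr div1r.
have [pi [pis pie piy]] := shift_hom m d half.
by exists pi; split=> // a ad; [apply: pis|apply: pie]; lia.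
Qed.
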